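(* For every $\epsilon > 0$ and every integer $k \geq 2$ there exists $\Delta_0$ such that the following holds for every integer $\Delta \geq \Delta_0$. Let $H$ be a $k$-partite $k$-uniform hypergraph of maximum degree at most $\Delta$. Then \[\chi_\ell(H) \leq \left((k-1+\epsilon)\frac{\Delta}{\log \Delta}\right)^{1/(k-1)}.\]
   Context: A $k$-uniform hypergraph ($k$-graph) $H=(V,E)$ has $E$ a collection of $k$-element subsets of $V$. It is $k$-partite if $V$ can be partitioned into $V_1,\dots,V_k$ such that every edge contains exactly one vertex from each $V_i$. The degree of a vertex is the number of edges containing it. A proper coloring is an assignment of colors to vertices such that no edge has all its vertices of the same color (at least two distinct colors appear on each edge). A list assignment is a function $L: V \to 2^{\mathbb{N}}$; a proper $L$-coloring is a proper coloring in which each vertex $v$ receives a color from $L(v)$. The list chromatic number $\chi_\ell(H)$ is the least $q$ such that $H$ has a proper $L$-coloring for every list assignment $L$ with $|L(v)| \geq q$ for all $v$. $\log$ denotes the natural logarithm. *)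

(* Defs.v *)
From mathcomp Require Import all_boot all_order all_algebra.
From mathcomp Require Import all_classical all_reals all_analysis.

Set Implicit Arguments.
Unset Strict Implicit.
Unset Printing Implicit Defensive.

Import Order.TTheory GRing.Theory Num.Theory.

(* A finite hypergraph on the vertex type V is given by its set of edges
   E : {set {set V}}. *)

Definition uniform (k : nat) (V : finType) (E : {set {set V}}) : Prop :=
  forall e : {set V}, e \in E -> #|e| = k.

(* The partition V_1, ..., V_k is the family of fibres of part; as usual for
   k-partite hypergraphs, a part may be empty. *)
Definition partite (k : nat) (V : finType) (E : {set {set V}}) : Prop :=
  exists part : V -> 'I_k, forall e : {set V}, e \in E ->
    forall i : 'I_k, #|[pred v in e | part v == i]| = 1%N.

Definition degree (V : finType) (E : {set {set V}}) (v : V) : nat :=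
  #|[pred e in E | v \in e]|.

Definition max_degree (V : finType) (E : {set {set V}}) : nat :=
  \max_(v : V) degree E v.

Definition proper_coloring (V : finType) (E : {set {set V}}) (c : V -> nat) :
    Prop :=
  forall e : {set V}, e \in E ->
    exists u v : V, [/\ u \in e, v \in e & c u <> c v].

(* Lists are arbitrary, possibly infinite, sets of natural numbers;
   `I_q #<= L v says that L v has at least q elements. *)
Definition choosable (V : finType) (E : {set {set V}}) (q : nat) : Prop :=
  forall L : V -> set nat, (forall v : V, (`I_q #<= L v)%card) ->
    exists c : V -> nat, (forall v : V, L v (c v)) /\ proper_coloring E c.

(* The least q such that E is choosable. The default value 0 is only taken
   when there is no such q, i.e. when some edge has at most one vertex; see
   list_chromatic_numberP. *)
Definition list_chromatic_number (V : finType) (E : {set {set V}}) : nat :=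
  xget 0%N (fun q : nat =>
    choosable E q /\ forall q' : nat, choosable E q' -> (q <= q')%N).

Lemma injective_list_coloring (V : finType) (L : V -> set nat) (s : seq V) :
  uniq s -> (forall v : V, (`I_(size s) #<= L v)%card) ->
  exists c : V -> nat, {in s, forall v, L v (c v)} /\ {in s &, injective c}.
Proof.
move=> us Ls.
suff H t : uniq t -> (size t <= size s)%N ->
    exists c : V -> nat, {in t, forall v, L v (c v)} /\ {in t &, injective c}.
  exact: H.
elim: t => [_ _|v t IHt /= /andP[vt ut] ts].
  by exists (fun=> 0%N); split.
have [c [Lc injc]] := IHt ut (ltnW ts).
have [a La act] : exists2 a, L v a & a \notin [seq c u | u <- t].
  apply: contrapT => /forall2NP Hno.
  have [f] := pcard_leP (Ls v).
  have sub : {subset [seq f i | i <- iota 0 (size s)] <= [seq c u | u <- t]}.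
    move=> y /mapP[i]; rewrite mem_iota /= => ilt ->{y}.
    have [//|/negP] := Hno (f i); last by rewrite negbK.
    by case; apply: (@funS _ _ _ _ f).
  have uf : uniq [seq f i | i <- iota 0 (size s)].
    rewrite map_inj_in_uniq ?iota_uniq// => i j.
    rewrite !mem_iota /= => ilt jlt fij.
    by apply: (@inj _ _ _ f); rewrite ?inE.
  by have := uniq_leq_size uf sub; rewrite !size_map size_iota leqNgt ts.
have neqv u : u \in t -> (u == v) = false.
  by move=> ut'; apply/negP => /eqP uv; rewrite -uv ut' in vt.
exists (fun u => if u == v then a else c u); split.
  move=> u; rewrite inE; case: eqP => [-> //|_ /= ut']; exact: Lc.
move=> x y; rewrite !inE.
case: (eqVneq x v) => [->|xv]; case: (eqVneq y v) => [->|yv] //= xt yt.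
- by move=> ac; rewrite ac map_f in act.
- by move=> ac; rewrite -ac map_f in act.
- exact: injc.
Qed.

Lemma choosable_card (k : nat) (V : finType) (E : {set {set V}}) :
  (2 <= k)%N -> uniform k E -> choosable E #|V|.
Proof.
move=> k2 Ek L HL.
have [|v|c [Lc injc]] := @injective_list_coloring V L (enum V).
- exact: enum_uniq.
- by rewrite -cardE.
exists c; split=> [v|e eE]; first by apply: Lc; rewrite mem_enum.
have /card_gt1P[u [v [ue ve uv]]] : (1 < #|e|)%N by rewrite (Ek _ eE).
exists u, v; split=> // cuv; move/eqP: uv; apply.
by apply: injc => //; rewrite mem_enum.
Qed.

Lemma list_chromatic_numberP (k : nat) (V : finType) (E : {set {set V}}) :
  (2 <= k)%N -> uniform k E ->
  choosable E (list_chromatic_number E) /\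
  forall q : nat, choosable E q -> (list_chromatic_number E <= q)%N.
Proof.
move=> k2 Ek; rewrite /list_chromatic_number.
have ex : exists q, `[< choosable E q >].
  by exists #|V|; apply/asboolP; apply: choosable_card k2 Ek.
case: xgetP => [q _ //|/(_ (ex_minn ex)) []].
case: ex_minnP => m /asboolP Em minm; split=> // q Eq.
by apply: minm; apply/asboolP.
Qed.

(* Main.v *)
(* Order the parts V_1, ..., V_k and colour every vertex outside V_k by a
   uniformly random element of its list of size q. A vertex v of V_k can be
   coloured unless each of its q colours j is blocked, i.e. some edge through v
   has its k - 1 other vertices coloured j.
   The indicator that j is blocked is 1 - prod_e (1 - prod_u x_u) at the 0/1
   vector x_u = [u is coloured j]. This function is nondecreasing and concave
   in each coordinate separately, and the events "u is coloured j" are disjoint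
   for distinct j. Hence replacing, one vertex u at a time, all the indicators
   of u by the constant 1/q can only increase the expectation of the product
   over j, and
     P(all colours of v are blocked) <= (1 - (1 - q^-(k-1))^Delta)^q.
   For q^(k-1) slightly below (k - 1 + eps) Delta / ln Delta the right-hand side
   is at most Delta^-4, and the local lemma provides a colouring blocking no
   vertex of V_k completely. *)

Require Import Defs.
(* all_boot comes last, so that set0, setT, ... are those of finset. *)
From mathcomp Require Import all_classical all_reals all_analysis.
From mathcomp Require Import all_boot all_order all_algebra.
From mathcomp Require Import ring lra.

Set Implicit Arguments.
Unset Strict Implicit.
Unset Printing Implicit Defensive.

Import Order.TTheory GRing.Theory Num.Theory.
Local Open Scope ring_scope.

Lemma leq_card_bigcup (I T : finType) (S : {pred I}) (F : I -> {set T}) :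
  (#|\bigcup_(i in S) F i| <= \sum_(i in S) #|F i|)%N.
Proof.
elim/big_rec2: _ => [|j n C _ h]; first by rewrite cards0.
by apply: (leq_trans (leq_card_setU _ _)); rewrite leq_add2l.
Qed.

(** * Uniform probability on a product space, in counting form *)

Section ProductSpace.
Variables (R : realFieldType) (V A : finType).
Implicit Types (phi psi : {ffun V -> A}) (f g : {ffun V -> A} -> R).

Definition mix (T : {set V}) phi psi : {ffun V -> A} :=
  [ffun u => if u \in T then phi u else psi u].

Lemma mixK T phi psi : mix T (mix T phi psi) (mix T psi phi) = phi.
Proof. by apply/ffunP => u; rewrite !ffunE; case: (u \in T). Qed.

(** Exchanging the coordinates in [T] between [phi] and [psi] is an involution on pairs, so it
    reindexes the double sum. *)
Lemma sum_mix T f g :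
  \sum_phi \sum_psi f (mix T phi psi) * g (mix T psi phi) =
  (\sum_phi f phi) * (\sum_phi g phi).
Proof.
rewrite mulr_suml.
under [RHS]eq_bigr => phi _ do rewrite mulr_sumr.
rewrite !pair_big /=.
pose h (w : {ffun V -> A} * {ffun V -> A}) := (mix T w.1 w.2, mix T w.2 w.1).
have hK : cancel h h by case=> phi psi; rewrite /h /= !mixK.
by rewrite [RHS](reindex h) //; exists h => ? _; rewrite hK.
Qed.

Definition supported (T : {set V}) f :=
  forall phi psi, {in T, phi =1 psi} -> f phi = f psi.

(** Independence: functions of disjoint sets of coordinates are uncorrelated. The factor
    [#|{: {ffun V -> A}}|] clears the denominators of the expectations. *)
Lemma sum_indep T f g : supported T f -> supported (~: T) g ->
  #|{: {ffun V -> A}}|%:R * (\sum_phi f phi * g phi) =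
  (\sum_phi f phi) * (\sum_phi g phi).
Proof.
move=> fT gT; rewrite -(sum_mix T) mulr_natl.
under [RHS]eq_bigr => phi _.
  under eq_bigr => psi _.
    rewrite (fT _ phi); last by move=> u uT; rewrite ffunE uT.
    rewrite (gT _ phi); last first.
      by move=> u; rewrite inE ffunE => /negbTE->.
  over.
  rewrite sumr_const.
over.
by rewrite sumrMnl cardT -cardE.
Qed.

(** Resampling one coordinate preserves the uniform distribution: swapping the fresh value with
    [phi u] is an involution on pairs. *)
Lemma sum_update f u :
  \sum_(phi : {ffun V -> A}) \sum_a f [ffun w => if w == u then a else phi w] =
  #|A|%:R * \sum_phi f phi.
Proof.
rewrite pair_big mulr_natl -sumrMnl.
under [RHS]eq_bigr => phi _ do rewrite -sumr_const.
rewrite pair_big /=.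
pose h (w : {ffun V -> A} * A) :=
  ([ffun x => if x == u then w.2 else w.1 x] : {ffun V -> A}, w.1 u).
have hK : cancel h h.
  case=> phi a; congr pair; last by rewrite /h /= ffunE eqxx.
  by apply/ffunP => x; rewrite !ffunE /=; case: eqP => // ->.
by rewrite [RHS](reindex h) /=; [|exists h => ? _; rewrite hK].
Qed.

(** * The symmetric Lovasz local lemma *)

Section LocalLemma.
Variables (I : finType) (B : I -> {set {ffun V -> A}}) (T : I -> {set V}).
Variables (p : R) (D : nat).
Hypothesis BT : forall i phi psi, {in T i, phi =1 psi} ->
  (phi \in B i) = (psi \in B i).
Hypothesis Bp : forall i, #|B i|%:R <= p * #|{: {ffun V -> A}}|%:R.
Hypothesis TD : forall i, (#|[set j | T i :&: T j != set0]| <= D)%N.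
Hypothesis D0 : (0 < D)%N.
Hypothesis p0 : 0 <= p.
Hypothesis pD : 4 * p * D%:R <= 1.
Hypothesis A0 : (0 < #|A|)%N.

Definition avoid (S : {set I}) : {set {ffun V -> A}} :=
  [set phi | [forall j in S, phi \notin B j]].

Lemma avoid_indep i (S : {set I}) :
  (forall j, j \in S -> T i :&: T j = set0) ->
  #|B i :&: avoid S|%:R <= p * #|avoid S|%:R.
Proof.
move=> TS.
have O0 : (0 : R) < #|{: {ffun V -> A}}|%:R.
  by rewrite ltr0n card_ffun expn_gt0 A0.
rewrite -(ler_pM2l O0).
have cardsum (C : {set {ffun V -> A}}) :
    #|C|%:R = \sum_phi (phi \in C)%:R :> R.
  by rewrite -sum1_card natr_sum big_mkcond; apply: eq_bigr => phi _; case: ifP.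
rewrite (cardsum (_ :&: _)).
under eq_bigr => phi _ do rewrite inE -mulnb natrM.
rewrite (@sum_indep (T i)) -?cardsum.
- by rewrite mulrCA mulrA ler_wpM2r.
- by move=> phi psi /BT ->.
move=> phi psi e; congr (nat_of_bool _)%:R; rewrite !inE.
apply: eq_forallb => j; case jS: (j \in S) => //=.
congr (~~ _); apply: BT => u uj; apply: e; rewrite inE.
apply/negP => ui; have := TS j jS => /setP/(_ u).
by rewrite !inE ui uj.
Qed.

(** Strong induction on the size of [S]. The events of [S] that share no coordinate with [B i] are
    conditioned on first; by the union bound, avoiding the at most [D] others as well loses at most
    half of the remaining assignments. *)
Lemma avoid_step n i (S : {set I}) : (#|S| <= n)%N ->
  #|B i :&: avoid S|%:R <= 2 * p * #|avoid S|%:R.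
Proof.
elim/ltn_ind: n i S => n IH i S Sn.
pose S1 := S :&: [set j | T i :&: T j != set0].
pose S2 := S :\: S1.
have sub : avoid S \subset avoid S2.
  apply/subsetP => phi; rewrite !inE => /forall_inP h.
  by apply/forall_inP => j; rewrite !inE => /andP[_ /h].
have le1 : (#|B i :&: avoid S|%:R : R) <= p * #|avoid S2|%:R.
  apply: (@le_trans _ _ #|B i :&: avoid S2|%:R).
    by rewrite ler_nat subset_leq_card// setIS.
  apply: avoid_indep => j; rewrite !inE.
  by case: (j \in S) => //=; rewrite andbT negbK => /eqP.
suff le2 : (#|avoid S2|%:R : R) <= 2 * #|avoid S|%:R.
  by apply: (le_trans le1); rewrite (mulrC 2) -mulrA ler_wpM2l.
(* The induction hypothesis needs [S2] strictly smaller than [S], hence [S1] nonempty. *)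
have [S10|S10] := eqVneq S1 set0.
  by rewrite /S2 S10 setD0 mulr_natl mulr2n lerDl.
have S2n : (#|S2| < n)%N.
  apply: leq_trans Sn; apply: proper_card; rewrite properE subsetDl /=.
  have [j jS1] := set0Pn _ S10; apply/subsetPn; exists j.
    by move: jS1; rewrite inE => /andP[].
  by rewrite inE jS1.
have S1D : (#|S1| <= D)%N.
  by apply: leq_trans (TD i); rewrite subset_leq_card// subsetIr.
have cover : (#|avoid S2| <= #|avoid S| + \sum_(j in S1) #|B j :&: avoid S2|)%N.
  have : avoid S2 \subset avoid S :|: \bigcup_(j in S1) (B j :&: avoid S2).
    apply/subsetP => phi h2; rewrite inE.
    have [//|] := boolP (phi \in avoid S).
    rewrite inE => /forall_inPn[j jS]; rewrite negbK => jB.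
    have jS1 : j \in S1.
      apply/negPn/negP => jS1; move: h2; rewrite inE => /forall_inP/(_ j).
      by rewrite in_setD jS1 jS jB => /(_ isT).
    by apply/bigcupP; exists j => //; rewrite in_setI jB.
  move/subset_leq_card/leq_trans; apply.
  apply: (leq_trans (leq_card_setU _ _)); rewrite leq_add2l.
  exact: leq_card_bigcup.
have : (\sum_(j in S1) #|B j :&: avoid S2|)%:R <= #|avoid S2|%:R / 2 :> R.
  rewrite natr_sum.
  apply: (@le_trans _ _ (\sum_(j in S1) 2 * p * #|avoid S2|%:R)).
    by apply: ler_sum => j _; apply: IH S2n _ _ _.
  rewrite sumr_const -[leLHS]mulr_natl.
  apply: (@le_trans _ _ (D%:R * (2 * p * #|avoid S2|%:R))).
    by rewrite ler_wpM2r ?ler_nat// !mulr_ge0.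
  rewrite [leLHS](_ : _ = #|avoid S2|%:R * (4 * p * D%:R / 2)); last by field.
  by rewrite ler_wpM2l// -[leRHS]mul1r ler_wpM2r// invr_ge0.
move: cover; rewrite -(ler_nat R) natrD; lra.
Qed.

(** When the events are added one at a time, each removes at most a proportion [2 * p <= 1 / 2] of
    the assignments avoiding the earlier ones, so some assignment survives. *)
Lemma local_lemma : exists phi, forall i, phi \notin B i.
Proof.
suff /card_gt0P[phi] : (0 < #|avoid setT|)%N.
  rewrite inE => /forall_inP h; exists phi => i; exact: h.
have H (S : {set I}) : (0 < #|avoid S|)%N.
  move E : #|S| => n; elim: n S E => [|n IH] S.
    move=> /eqP; rewrite cards_eq0 => /eqP->.
    have /card_gt0P[phi _] : (0 < #|{: {ffun V -> A}}|)%N.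
      by rewrite card_ffun expn_gt0 A0.
    by apply/card_gt0P; exists phi; rewrite inE; apply/forall_inP => j; rewrite inE.
  move=> E; have /card_gt0P[i iS] : (0 < #|S|)%N by rewrite E.
  have /IH S0 : #|S :\ i| = n by move: E; rewrite (cardsD1 i) iS => -[].
  have := @avoid_step _ i (S :\ i) (leqnn _).
  have -> : avoid S = avoid (S :\ i) :\: B i.
    apply/setP => phi; rewrite !inE; apply/forall_inP/andP.
      move=> h; split; first exact: h.
      by apply/forall_inP => j; rewrite !inE => /andP[_]; exact: h.
    move=> [iB /forall_inP h] j jS; have [->//|ji] := eqVneq j i.
    by apply: h; rewrite !inE ji.
  have := cardsID (B i) (avoid (S :\ i)); rewrite setIC => /(congr1 (fun x => x%:R : R)).
  rewrite natrD -(ltr_nat R) => e le.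
  have D1 : (1 : R) <= D%:R by rewrite ler1n.
  have S1 : (0 : R) < #|avoid (S :\ i)|%:R by rewrite ltr0n.
  have p4 : 4 * p <= 1 by apply: le_trans pD; rewrite ler_peMr// mulr_ge0.
  nra.
exact: H.
Qed.
End LocalLemma.

End ProductSpace.

(** * Two inequalities for products *)

Section Convexity.
Variable R : realFieldType.

(** Induction on [s]: once the induction hypothesis is applied, the gap is
    [t * (1 - t) * ((a i - b i) * (Q - P))], nonnegative because [a] dominates [b] in every
    factor. *)
Lemma prod_convex (I : Type) (s : seq I) (a b : I -> R) (t : R) :
  0 <= t <= 1 -> (forall i, 0 <= b i <= a i) ->
  \prod_(i <- s) ((1 - t) * a i + t * b i) <=
  (1 - t) * \prod_(i <- s) a i + t * \prod_(i <- s) b i.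
Proof.
move=> /andP[t0 t1] ab; elim: s => [|i s IH]; first by rewrite !big_nil; lra.
rewrite !big_cons; have /andP[b0 ba] := ab i.
have B0 : 0 <= \prod_(j <- s) b j by apply: prodr_ge0 => j _; case/andP: (ab j).
have BA : \prod_(j <- s) b j <= \prod_(j <- s) a j by apply: ler_prod.
set P := \prod_(j <- s) b j in B0 BA IH *.
set Q := \prod_(j <- s) a j in BA IH *.
apply: (@le_trans _ _
    (((1 - t) * a i + t * b i) * ((1 - t) * Q + t * P))).
  by rewrite ler_wpM2l// addr_ge0// mulr_ge0//; lra.
rewrite -subr_ge0.
rewrite [leRHS](_ : _ = t * (1 - t) * ((a i - b i) * (Q - P))); last by ring.
by rewrite !mulr_ge0// subr_ge0.
Qed.

(* The relation m is a partial matching, so at most one factor changes for each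
   i: the left-hand side is a first-order expansion of the right-hand side. *)
Lemma sum_prod_matching (I J : finType) (m : I -> J -> bool) (a b : J -> R)
    (s : seq J) :
  (forall i j j', m i j -> m i j' -> j = j') ->
  (forall i i' j, m i j -> m i' j -> i = i') ->
  (0 < #|I|)%N -> (forall j, 0 <= a j <= b j) -> uniq s ->
  \sum_i \prod_(j <- s) (if m i j then b j else a j) <=
  #|I|%:R * \prod_(j <- s) (a j + (b j - a j) / #|I|%:R).
Proof.
move=> mr ml I0 ab; elim: s => [_|j s IH /= /andP[js us]].
  by rewrite big_nil (eq_bigr (fun=> 1)) ?sumr_const ?mulr1// => i _; rewrite big_nil.
have {}IH := IH us; have /andP[a0 ajb] := ab j.
have n0 : (0 : R) < #|I|%:R by rewrite ltr0n.
have ge0 j' : 0 <= (b j' - a j') / #|I|%:R.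
  by rewrite divr_ge0 ?ler0n// subr_ge0; case/andP: (ab j').
rewrite big_cons; set P := \prod_(j <- s) _ in IH *.
have aP : \prod_(j' <- s) a j' <= P.
  by apply: ler_prod => j' _; rewrite lerDl ge0 andbT; case/andP: (ab j').
have P0 : 0 <= P by apply: le_trans aP; apply: prodr_ge0 => j' _; case/andP: (ab j').
pose Q i := \prod_(j' <- s) (if m i j' then b j' else a j').
rewrite (eq_bigr (fun i => a j * Q i + (m i j)%:R * (b j - a j) * Q i)); last first.
  move=> i _; rewrite big_cons -mulrDl; congr (_ * _).
  by case: (m i j) => /=; ring.
rewrite big_split /= -mulr_sumr [leRHS]mulrCA [leRHS]mulrDl.
apply: lerD; first exact: ler_wpM2l.
rewrite [leRHS]mulrA divfK ?gt_eqF//.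
(* Only the [i0] matched to [j] contributes the increment [b j - a j]. As [i0] is matched to nothing
   else, its other factors are all [a j'], with product at most [P]. *)
have [/existsP[i0 mi0]|/existsPn no] := boolP [exists i, m i j]; last first.
  rewrite big1 ?mulr_ge0 ?subr_ge0// => i _.
  by rewrite (negbTE (no i)) !mul0r.
rewrite (bigD1 i0)//= big1 => [|i ii0]; last first.
  case mi: (m i j); last by rewrite !mul0r.
  by rewrite (ml _ _ _ mi mi0) eqxx in ii0.
rewrite addr0 mi0 mul1r ler_wpM2l ?subr_ge0//.
rewrite (_ : Q i0 = \prod_(j' <- s) a j') // /Q !big_seq.
apply: eq_bigr => j' j's; case mj': (m i0 j') => //.
by rewrite (mr _ _ _ mi0 mj') j's in js.
Qed.
End Convexity.

(** * Replacing random colours by constants, one vertex at a time *)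

Section Blocking.
Variables (R : realFieldType) (V A : finType).
Variables (F : {set {set V}}) (m : V -> A -> A -> bool).
Hypothesis mr : forall u i j j', m u i j -> m u i j' -> j = j'.
Hypothesis ml : forall u i i' j, m u i j -> m u i' j -> i = i'.
Hypothesis A0 : (0 < #|A|)%N.

(** For fractional [x] the sets of [F] are treated as independent even when they overlap, so in
    general this is concave rather than affine in each coordinate. *)
Definition blocking (x : V -> R) : R :=
  1 - \prod_(f in F) (1 - \prod_(u in f) x u).

Definition set_at (x : V -> R) u t w := if w == u then t else x w.

Lemma prod_set_at (f : {set V}) (x : V -> R) u t :
  \prod_(w in f) set_at x u t w =
  (1 - t) * \prod_(w in f) set_at x u 0 w + t * \prod_(w in f) set_at x u 1 w.
Proof.
have [uf|uf] := boolP (u \in f).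
  have E c : \prod_(w in f) set_at x u c w = c * \prod_(w in f | w != u) x w.
    rewrite (bigD1 u)//= /set_at eqxx; congr (_ * _).
    by apply: eq_bigr => w /andP[_ /negbTE->].
  by rewrite !E; ring.
have E c : \prod_(w in f) set_at x u c w = \prod_(w in f) x w.
  apply: eq_bigr => w wf; rewrite /set_at; case: eqP => // wu.
  by rewrite -wu wf in uf.
by rewrite !E; ring.
Qed.

Lemma prod01 (I : finType) (P : pred I) (x : I -> R) :
  (forall i, P i -> 0 <= x i <= 1) -> 0 <= \prod_(i | P i) x i <= 1.
Proof.
move=> x01; rewrite prodr_ile1// andbT.
by apply: prodr_ge0 => i /x01/andP[].
Qed.

Lemma onem01 (c : R) : 0 <= c <= 1 -> 0 <= 1 - c <= 1.
Proof. by move=> /andP[c0 c1]; rewrite subr_ge0 c1 lerBlDr lerDl. Qed.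

Lemma blocking_mono (x y : V -> R) : (forall u, 0 <= x u <= y u) ->
  (forall u, y u <= 1) -> 0 <= blocking x <= blocking y.
Proof.
move=> xy y1.
have x01 u : 0 <= x u <= 1 by have /andP[-> /le_trans ->] := xy u.
have y01 u : 0 <= y u <= 1 by have /andP[/le_trans h /h ->] := xy u; rewrite y1.
rewrite /blocking.
have /onem01/andP[-> _] /= : 0 <= \prod_(f in F) (1 - \prod_(u in f) x u) <= 1.
  by apply: prod01 => f _; apply: onem01; apply: prod01.
rewrite lerB//; apply: ler_prod => f _.
have /onem01/andP[-> _] /= : 0 <= \prod_(u in f) y u <= 1 by apply: prod01.
by rewrite lerB// ler_prod.
Qed.

Lemma set_at01 (x : V -> R) u t : (forall w, 0 <= x w <= 1) -> 0 <= t <= 1 ->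
  forall w, 0 <= set_at x u t w <= 1.
Proof. by move=> x01 t01 w; rewrite /set_at; case: ifP. Qed.

Lemma set_at_le (x : V -> R) u t t' : (forall w, 0 <= x w <= 1) -> 0 <= t <= t' ->
  forall w, 0 <= set_at x u t w <= set_at x u t' w.
Proof.
move=> x01 t01 w; rewrite /set_at; case: ifP => //.
by rewrite lexx andbT; case/andP: (x01 w).
Qed.

(** Each inner product is affine in the coordinate [u], so [prod_convex] makes the product over [F]
    convex along it. *)
Lemma blocking_concave (x : V -> R) u t : (forall w, 0 <= x w <= 1) ->
  0 <= t <= 1 ->
  (1 - t) * blocking (set_at x u 0) + t * blocking (set_at x u 1) <=
  blocking (set_at x u t).
Proof.
move=> x01 t01; rewrite /blocking.
have := @prod_convex _ _ (enum F) (fun f => 1 - \prod_(w in f) set_at x u 0 w)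
  (fun f => 1 - \prod_(w in f) set_at x u 1 w) t t01.
have H01 (f : {set V}) : 0 <= 1 - \prod_(w in f) set_at x u 1 w <=
    1 - \prod_(w in f) set_at x u 0 w.
  rewrite subr_ge0 prodr_ile1 ?lerB//=; last first.
    by move=> w _; apply: set_at01; rewrite ?ler01 ?lexx.
  by apply: ler_prod => w _; apply: set_at_le; rewrite // lexx ler01.
move=> /(_ H01); rewrite !big_enum /=.
rewrite [X in X <= _ -> _](_ : _ =
    \prod_(f in F) (1 - \prod_(w in f) set_at x u t w)); first lra.
by apply: eq_bigr => f _; rewrite [in RHS]prod_set_at; ring.
Qed.

(** Interpolates between the random indicators ([S] empty) and the constant vector ([S] full). *)
Definition hybrid (S : {set V}) (phi : {ffun V -> A}) (j : A) (u : V) : R :=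
  if u \in S then #|A|%:R^-1 else (m u (phi u) j)%:R.

Lemma hybrid01 (S : {set V}) phi j u : 0 <= hybrid S phi j u <= 1.
Proof.
rewrite /hybrid; case: ifP => _.
  by rewrite invr_ge0 ler0n invf_le1 ?ltr0n// ler1n.
by case: (m _ _ _); rewrite ?lexx ler01.
Qed.

(** Resampling [u] gives a sum over its new value [i], to which [sum_prod_matching] applies;
    concavity at [t = #|A|%:R^-1] then bounds each averaged factor. *)
Lemma hybrid_step (S : {set V}) u : u \notin S ->
  \sum_phi \prod_j blocking (hybrid S phi j) <=
  \sum_phi \prod_j blocking (hybrid (u |: S) phi j).
Proof.
move=> uS; have n0 : (0 : R) < #|A|%:R by rewrite ltr0n.
rewrite -(ler_pM2l n0) -(sum_update _ u) mulr_sumr.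
apply: ler_sum => phi _.
pose x j := hybrid S phi j.
pose a j := blocking (set_at (x j) u 0).
pose b j := blocking (set_at (x j) u 1).
have x01 j w : 0 <= x j w <= 1 by exact: hybrid01.
have ab j : 0 <= a j <= b j.
  apply: blocking_mono => w.
    by apply: set_at_le; rewrite // lexx ler01.
  have t01 : 0 <= (1 : R) <= 1 by rewrite lexx ler01.
  by case/andP: (set_at01 u (x01 j) t01 w).
have eqb y z : y =1 z -> blocking y = blocking z.
  move=> yz; rewrite /blocking; congr (1 - _); apply: eq_bigr => f _.
  by congr (1 - _); apply: eq_bigr.
rewrite [leLHS](_ : _ = \sum_i \prod_j (if m u i j then b j else a j)); last first.
  apply: eq_bigr => i _; apply: eq_bigr => j _.
  transitivity (blocking (set_at (x j) u (m u i j)%:R)); last by case: (m u i j).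
  apply: eqb => w; rewrite /set_at /x /hybrid ffunE.
  by case: eqP => // ->; rewrite (negbTE uS).
apply: (le_trans (@sum_prod_matching _ _ _ (m u) a b _ (@mr u) (@ml u) A0 ab _)).
  by rewrite index_enum_uniq.
rewrite ler_pM2l//; apply: ler_prod => j _; apply/andP; split.
  have [aj abj] := andP (ab j).
  by apply: addr_ge0 => //; rewrite divr_ge0 ?ler0n// subr_ge0.
have -> : a j + (b j - a j) / #|A|%:R =
  (1 - #|A|%:R^-1) * a j + #|A|%:R^-1 * b j by ring.
apply: le_trans (blocking_concave _ _ _) _ => //.
  by rewrite invr_ge0 ler0n invf_le1 ?ltr0n// ler1n.
rewrite le_eqVlt; apply/orP; left; apply/eqP; apply: eqb => w.
rewrite /set_at /x /hybrid in_setU1; by case: eqP.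
Qed.

Definition blocked : {set {ffun V -> A}} :=
  [set phi : {ffun V -> A} |
    [forall j, exists f in F, forall u in f, m u (phi u) j]].

Lemma card_blocked K N : (forall f, f \in F -> #|f| = K) -> (#|F| <= N)%N ->
  #|blocked|%:R <=
  (1 - (1 - #|A|%:R^-1 ^+ K) ^+ N) ^+ #|A| * #|{: {ffun V -> A}}|%:R :> R.
Proof.
move=> FK FN.
have n01 : 0 <= (#|A|%:R^-1 : R) <= 1.
  by rewrite invr_ge0 ler0n invf_le1 ?ltr0n// ler1n.
(* A [phi] in [blocked] makes every factor equal to 1, and all other terms are nonnegative. *)
apply: (@le_trans _ _ (\sum_phi \prod_j blocking (hybrid set0 phi j))).
  rewrite -sum1_card natr_sum big_mkcond; apply: ler_sum => phi _.
  have ge0 j : 0 <= blocking (hybrid set0 phi j).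
    suff /andP[] : 0 <= blocking (hybrid set0 phi j) <=
      blocking (hybrid set0 phi j) by [].
    by apply: blocking_mono => u; have /andP[h0 h1] := hybrid01 set0 phi j u;
      rewrite ?lexx ?h0.
  case: ifPn => [|_]; last by apply: prodr_ge0.
  rewrite inE => /forallP B; rewrite big1// => j _.
  have /existsP[f /andP[fF /forall_inP fm]] := B j.
  rewrite /blocking (bigD1 f)//= [\prod_(u in f) _]big1 ?subrr ?mul0r ?subr0//.
  by move=> u uf; rewrite /hybrid inE fm.
have H (s : seq V) : \sum_phi \prod_j blocking (hybrid set0 phi j) <=
    \sum_phi \prod_j blocking (hybrid [set u in s] phi j).
  elim: s => [|u s IH].
    by rewrite (_ : [set u in [::]] = set0) // -setP => u; rewrite !inE.
  rewrite set_cons; have [us|us] := boolP (u \in [set u in s]).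
    by rewrite (setUidPr _) ?sub1set.
  exact: le_trans IH (hybrid_step us).
apply: le_trans (H (enum V)) _.
rewrite (_ : [set u in enum V] = setT); last by apply/setP => u; rewrite !inE mem_enum.
rewrite -[X in _ * X]sumr_const /= mulr_sumr.
rewrite cardT -cardE.
apply: ler_sum => phi _; rewrite mulr1.
(* With all vertices replaced, each factor depends only on the sizes of [F] and of its members, so
   [phi] drops out. *)
have -> : \prod_j blocking (hybrid setT phi j) =
    \prod_(j : A) (1 - (1 - #|A|%:R^-1 ^+ K) ^+ #|F|).
  apply: eq_bigr => j _; rewrite /blocking; congr (1 - _).
  rewrite -prodr_const; apply: eq_bigr => f fF; congr (1 - _).
  rewrite -(FK f fF) -prodr_const; apply: eq_bigr => u _.
  by rewrite /hybrid inE.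
have q01 : 0 <= 1 - (#|A|%:R^-1 : R) ^+ K <= 1.
  by case/andP: n01 => n0 n1; rewrite subr_ge0 exprn_ile1//= lerBlDr lerDl exprn_ge0.
have [q0 q1] := andP q01.
rewrite prodr_const; apply: lerXn2r.
- by rewrite nnegrE subr_ge0 exprn_ile1.
- by rewrite nnegrE subr_ge0 exprn_ile1.
by rewrite lerB// ler_wiXn2l.
Qed.
End Blocking.

(** * Estimates for the list size *)

Section Asymptotics.
Context {R : realType}.
Implicit Types (L c d e z : R) (K D q : nat).

Lemma expR_div_ge L : 0 < L -> L / 2 <= expR L / L.
Proof.
move=> L0; rewrite ler_pdivlMr//.
have := expR_ge1Dxn 1 (ltW L0); rewrite (_ : 2`! = 2)%N// => h.
have -> : L / 2 * L = L ^+ 2 / 2%:R by ring.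
by apply: le_trans h; rewrite lerDr.
Qed.

(** Invert [1 + x <= expR x] at [x = (z - 1)^-1]. *)
Lemma expRN_le_onemV z : 1 < z -> expR (- (z - 1)^-1) <= 1 - z^-1.
Proof.
move=> z1; have z10 : 0 < z - 1 by rewrite subr_gt0.
have z0 : 0 < z by apply: lt_trans z1.
rewrite expRN [leRHS](_ : _ = (1 + (z - 1)^-1)^-1); last first.
  by field; rewrite !gt_eqF// subrK.
by rewrite lef_pV2 ?posrE ?expR_gt0 ?expR_ge1Dx// addr_gt0// invr_gt0.
Qed.

(** Let [x] be the inner power and [d = 1/K - 1/c > 0]. Then [x >= expR (- (L / c))] and
    [q >= expR (L / K) / L], so [q * x >= expR (d * L) / L], which is at least [4 * L] for large
    [L]; conclude by [1 - x <= expR (- x)]. *)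
Lemma all_blocked_le K D q L c : (0 < K)%N -> D%:R = expR L -> 1 <= L ->
  K%:R < c -> c * (D%:R / L) + 1 <= q%:R ^+ K ->
  24 / (K%:R^-1 - c^-1) ^+ 3 <= L ->
  (1 - (1 - q%:R^-1 ^+ K) ^+ D) ^+ q <= expR (- (4 * L)).
Proof.
move=> K0 DL L1 Kc qK Ld.
have L0 : 0 < L by apply: lt_le_trans L1.
have D0 : 0 < D%:R :> R by rewrite DL expR_gt0.
have K0' : 0 < K%:R :> R by rewrite ltr0n.
have c0 : 0 < c by apply: lt_trans Kc.
have cD0 : 0 < c * (D%:R / L) by rewrite mulr_gt0// divr_gt0.
have Q1 : 1 < q%:R ^+ K :> R by apply: lt_le_trans qK; rewrite ltrDr.
set x := (1 - q%:R^-1 ^+ K) ^+ D.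
have xge : expR (- (L / c)) <= x.
  (* The summand 1 in the lower bound on [q ^ K] absorbs the [- 1] of [expRN_le_onemV]. *)
  have : expR (- (L / (c * D%:R))) <= 1 - q%:R^-1 ^+ K.
    rewrite exprVn; apply: le_trans (expRN_le_onemV Q1).
    rewrite ler_expR lerN2 -[leRHS]invf_div -mulrA.
    rewrite lef_pV2 ?posrE ?mulr_gt0 ?invr_gt0 ?subr_gt0//.
    by rewrite lerBrDr.
  rewrite -(ler_pXn2r (n := D)) ?nnegrE ?expR_ge0//; last 2 first.
  - by rewrite -(ltr0n R).
  - by rewrite subr_ge0 exprVn invf_le1 ?ltW// (lt_trans ltr01).
  rewrite -expRM_natl (_ : D%:R * _ = - (L / c))//.
  by field; rewrite !gt_eqF.
have x1 : x <= 1.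
  rewrite exprn_ile1 ?subr_ge0 ?lerBlDr ?lerDl ?exprn_ge0 ?invr_ge0//.
  by rewrite exprVn invf_le1 ?ltW// (lt_trans ltr01).
have qge : expR (L / K%:R) / L <= q%:R.
  rewrite -(ler_pXn2r K0) ?nnegrE ?divr_ge0 ?expR_ge0 ?(ltW L0)//.
  rewrite exprMn -expRM_natl (_ : K%:R * _ = L); last by field; rewrite gt_eqF.
  apply: (@le_trans _ _ (1 * (D%:R / L) + 0)); last first.
    apply: le_trans qK; apply: lerD => //; rewrite ler_wpM2r ?divr_ge0 ?ltW//.
    by apply: le_lt_trans Kc; rewrite ler1n.
  rewrite mul1r addr0 -DL ler_wpM2l// ?(ltW D0)// exprVn lef_pV2 ?posrE ?exprn_gt0//.
  by rewrite ler_eXnr.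
set d := K%:R^-1 - c^-1 in Ld.
have d0 : 0 < d by rewrite subr_gt0 ltf_pV2.
have qx : 4 * L <= q%:R * x.
  have : expR (d * L) / L <= q%:R * x.
    have -> : expR (d * L) / L = expR (L / K%:R) / L * expR (- (L / c)).
      by rewrite mulrAC -expRD; congr (expR _ / _); rewrite /d; ring.
    by apply: ler_pM; rewrite ?divr_ge0 ?expR_ge0 ?(ltW L0).
  apply: le_trans; rewrite ler_pdivlMr//.
  (* The cubic term [(d * L)^3 / 6] alone is at least [4 * L^2] when [L * d^3 >= 24], whence the
     constant 24. *)
  have := expR_ge1Dxn 2 (ltW (mulr_gt0 d0 L0)); rewrite (_ : 3`! = 6)%N// => h.
  apply: le_trans h; rewrite ler_wpDl//.
  move: Ld; rewrite ler_pdivrMr ?exprn_gt0// => Ld.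
  have -> : (d * L) ^+ 3 / 6 = (L * d ^+ 3) * L ^+ 2 / 6 by ring.
  have := ler_wpM2r (exprn_ge0 2 (ltW L0)) Ld; lra.
apply: (@le_trans _ _ (expR (- x) ^+ q)).
  apply: lerXn2r; rewrite ?nnegrE ?subr_ge0 ?expR_ge0//.
  exact: expR_ge1Dx.
by rewrite -expRM_natl ler_expR mulrN lerN2.
Qed.

Lemma exists_list_size e K : 0 < e -> (0 < K)%N ->
  exists D0 : nat, forall D, (D0 <= D)%N -> exists q : nat,
    [/\ (0 < q)%N,
      q%:R <= ((K%:R + e) * (D%:R / ln (D%:R : R))) `^ K%:R^-1 &
      4 * (1 - (1 - q%:R^-1 ^+ K) ^+ D) ^+ q * ((K.+1 * D) ^ 2)%:R <= 1 :> R].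
Proof.
move=> e0 K0; have K0' : 0 < K%:R :> R by rewrite ltr0n.
(* The slack [e] is split: [e / 4] makes [c > K], another [e / 4] absorbs the summand 1 of [z], and
   the rest, through [r < 1], pays for rounding [q] up. *)
pose c : R := K%:R + e / 4.
pose rho : R := (K%:R + e / 2) / (K%:R + e).
have rho0 : 0 < rho by rewrite divr_gt0//; lra.
have rho1 : rho < 1 by rewrite ltr_pdivrMr; lra.
have Ki0 : 0 < K%:R^-1 :> R by rewrite invr_gt0.
have r1 : rho `^ K%:R^-1 < 1.
  rewrite [ltRHS](_ : 1 = 1 `^ K%:R^-1); last by rewrite powR1.
  by apply: gt0_ltr_powR => //; rewrite nnegrE ltW.
set r := rho `^ K%:R^-1 in r1.
have d0 : 0 < K%:R^-1 - c^-1.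
  by rewrite subr_gt0 ltf_pV2 ?posrE// /c; lra.
(* One summand per lower bound needed on [L]: [L1], the rounding of [q], the hypothesis of
   [all_blocked_le], and [DLe]. *)
pose M : R := 1 + 2 * (1 - r)^-1 ^+ K + 24 / (K%:R^-1 - c^-1) ^+ 3 + 8 / e.
(* The bound [2 * K.+1 <= D] serves the last estimate, whose left-hand side becomes
   [(K.+1 * 2 / D)^2]. *)
exists (2 * K.+1 + (Num.truncn (expR M)).+1)%N => D D0D.
have [kD MD] : (2 * K.+1 <= D)%N /\ expR M <= D%:R.
  split; first by apply: leq_trans D0D; rewrite leq_addr.
  apply: (le_trans (ltW (truncnS_gt _))); rewrite ler_nat.
  by apply: leq_trans D0D; rewrite leq_addl.
have D0 : 0 < D%:R :> R by apply: lt_le_trans MD; rewrite expR_gt0.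
set L := ln D%:R; have DL : D%:R = expR L by rewrite lnK.
have ML : M <= L by rewrite -ler_expR -DL.
have t1 : 0 <= 2 * (1 - r)^-1 ^+ K by rewrite mulr_ge0// exprn_ge0// invr_ge0; lra.
have t2 : 0 <= 24 / (K%:R^-1 - c^-1) ^+ 3 by rewrite divr_ge0// exprn_ge0// ltW.
have t3 : 0 <= 8 / e by rewrite divr_ge0// ltW.
have L1 : 1 <= L by apply: le_trans ML; rewrite /M; lra.
have L2 : 2 * (1 - r)^-1 ^+ K <= L by apply: le_trans ML; rewrite /M; lra.
have L3 : 24 / (K%:R^-1 - c^-1) ^+ 3 <= L by apply: le_trans ML; rewrite /M; lra.
have L4 : 8 / e <= L by apply: le_trans ML; rewrite /M; lra.
have L0 : 0 < L by lra.
have DLL : L / 2 <= D%:R / L by rewrite DL expR_div_ge.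
have DLe : 1 <= e / 4 * (D%:R / L).
  by move: L4; rewrite ler_pdivrMr// => L4; nra.
have DL0 : 0 < D%:R / L by rewrite divr_gt0.
pose z := c * (D%:R / L) + 1.
pose y := (K%:R + e) * (D%:R / L).
have y0 : 0 < y by rewrite mulr_gt0// addr_gt0.
have z0 : 0 < z by rewrite addr_gt0// mulr_gt0// /c; lra.
have zy : z <= rho * y.
  have -> : rho * y = (K%:R + e / 2) * (D%:R / L).
    by rewrite /rho /y; field; rewrite !gt_eqF// addr_gt0.
  rewrite /z /c; lra.
pose q := (Num.truncn (z `^ K%:R^-1)).+1.
exists q; split => //.
  apply: (@le_trans _ _ (z `^ K%:R^-1 + 1)).
    by rewrite /q -natr1 lerD2r truncn_le powR_ge0.
  apply: (@le_trans _ _ (r * y `^ K%:R^-1 + 1)).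
    rewrite lerD2r /r -powRM ?(ltW rho0) ?(ltW y0)//.
    by apply: ge0_ler_powR; [rewrite ltW|rewrite nnegrE ltW|rewrite nnegrE mulr_ge0 ?ltW|].
  (* This is equivalent to [r * Y + 1 <= Y] for [Y] the root of [y], which leaves room for the
     rounding. *)
  have : (1 - r)^-1 <= y `^ K%:R^-1.
    have r10 : 0 <= (1 - r)^-1 by rewrite invr_ge0 subr_ge0 ltW.
    rewrite -(ler_pXn2r K0) ?nnegrE ?powR_ge0// -[leRHS]powR_mulrn ?powR_ge0//.
    rewrite -powRrM mulVf ?gt_eqF// powRr1 ?(ltW y0)//.
    apply: (@le_trans _ _ (1 * (D%:R / L))); first by lra.
    rewrite ler_wpM2r ?ltW//; have : 1 <= K%:R :> R by rewrite ler1n.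
    lra.
  rewrite -[_^-1]mul1r ler_pdivrMr ?subr_gt0// => h.
  by rewrite -/y; lra.
have qz : z <= q%:R ^+ K.
  have : z `^ K%:R^-1 <= q%:R by apply/ltW/truncnS_gt.
  rewrite -(ler_pXn2r K0) ?nnegrE ?powR_ge0// -[leLHS]powR_mulrn ?powR_ge0//.
  by rewrite -powRrM mulVf ?gt_eqF// powRr1 ?(ltW z0).
have Kc : K%:R < c by rewrite /c; lra.
have h := @all_blocked_le K D q L c K0 DL L1 Kc qz L3.
apply: (@le_trans _ _ (4 * expR (- (4 * L)) * ((K.+1 * D) ^ 2)%:R)).
  by rewrite ler_wpM2r// ler_wpM2l.
rewrite -mulrN expRM_natl expRN -DL natrX natrM.
have k1 : K.+1%:R * 2 / D%:R <= 1 :> R.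
  by rewrite ler_pdivrMr// mul1r -natrM ler_nat mulnC.
have D1 : D%:R^-1 <= 1 :> R by rewrite invf_le1// ler1n -(ltr0n R).
have -> : 4 * D%:R^-1 ^+ 4 * (K.+1%:R * D%:R) ^+ 2 =
  (K.+1%:R * 2 / D%:R) ^+ 2 :> R by field; rewrite gt_eqF.
by rewrite exprn_ile1// !mulr_ge0// invr_ge0 ltW.
Qed.
End Asymptotics.

(** * From the local lemma to list colourings *)

Section ListColoring.
Context {V : finType}.
Implicit Types (E : {set {set V}}) (u v : V).

Definition star E v : {set {set V}} := [set e in E | v \in e].

Definition link E v : {set {set V}} := [set e :\ v | e in star E v].

Lemma card_star E v D : (max_degree E <= D)%N -> (#|star E v| <= D)%N.
Proof.
apply: leq_trans; rewrite /max_degree.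
apply: leq_trans (leq_bigmax v); rewrite /degree.
by rewrite (@eq_card _ _ [pred e in E | v \in e])// => e; rewrite !inE.
Qed.

(** Such a [w] is reached from [v] through an edge [e] at [v], a vertex [u] of [e], an edge [e'] at
    [u], and [w] in [e']: at most [D * k * D * k] choices. *)
Lemma card_meeting_links E v k D : uniform k E -> (max_degree E <= D)%N ->
  (#|[set w | cover (link E v) :&: cover (link E w) != set0]| <=
   (k * D) ^ 2)%N.
Proof.
move=> Ek ED.
have cardU (I : finType) (S : {set I}) (F : I -> {set V}) s n :
    (#|S| <= s)%N -> (forall i, i \in S -> #|F i| <= n)%N ->
    (#|\bigcup_(i in S) F i| <= s * n)%N.
  move=> Ss Fn; apply: (leq_trans (leq_card_bigcup _ _)).
  apply: (@leq_trans (\sum_(i in S) n)); first exact: leq_sum.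
  by rewrite sum_nat_const leq_mul2r Ss orbT.
apply: (@leq_trans #|\bigcup_(e in star E v) \bigcup_(u in e)
    \bigcup_(e' in star E u) e'|).
  apply/subset_leq_card/subsetP => w; rewrite inE => /set0Pn[u].
  rewrite inE => /andP[/bigcupP[f /imsetP[e ev ->] ue]].
  case/bigcupP => f' /imsetP[e' e'w ->] ue'.
  apply/bigcupP; exists e => //; apply/bigcupP; exists u.
    by move: ue; rewrite inE => /andP[].
  apply/bigcupP; exists e'; last by move: e'w; rewrite inE => /andP[].
  by move: e'w ue'; rewrite !inE => /andP[-> _] /andP[_ ->].
rewrite (_ : (k * D) ^ 2 = D * (k * (D * k)))%N; last by rewrite mulnA (mulnC D k).
apply: (cardU) => [|e]; first exact: card_star.
rewrite inE => /andP[eE _]; apply: (cardU) => [|u _]; first by rewrite (Ek _ eE).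
apply: (cardU) => [|e']; first exact: card_star.
by rewrite inE => /andP[e'E _]; rewrite (Ek _ e'E).
Qed.

Lemma partite_choosable (R : realFieldType) E K D q :
  uniform K.+1 E -> partite K.+1 E -> (max_degree E <= D)%N ->
  (0 < D)%N -> (0 < q)%N ->
  4 * (1 - (1 - q%:R^-1 ^+ K) ^+ D) ^+ q * ((K.+1 * D) ^ 2)%:R <= 1 :> R ->
  choosable E q.
Proof.
move=> Ek [part partE] ED D0 q0 pD L HL.
(* Fix [q] distinct colours in each list; random colours become indices in ['I_q]. *)
have /choice[l lP] v : exists f : 'I_q -> nat,
    injective f /\ forall i, L v (f i).
  have [f] := pcard_leP (HL v); exists (fun i => f i); split=> [i j fij|i].
    by apply/val_inj/(@inj _ _ _ f) => //; apply/mem_set; exact: ltn_ord.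
  by apply: (@funS _ _ _ _ f); exact: ltn_ord.
have linj v : injective (l v) by have [] := lP v.
(* Equal colours can have different indices at [u] and [v]; injectivity of [l] makes this relation a
   partial matching. *)
pose m v (u : V) (i j : 'I_q) := l u i == l v j.
pose last v := part v == ord_max.
(* Vertices outside the last part get an empty event with empty support, so that all of [V] can
   index the events. *)
pose B v := if last v then blocked (link E v) (m v) else set0.
pose T v := if last v then cover (link E v) else set0.
have q0' : (0 < #|'I_q|)%N by rewrite card_ord.
have q01 : 0 <= 1 - (q%:R^-1 : R) ^+ K <= 1.
  by apply: onem01; rewrite exprn_ge0 ?exprn_ile1 ?invr_ge0 ?ler0n ?invf_le1 ?ltr0n ?ler1n.
have p0 : 0 <= (1 - (1 - q%:R^-1 ^+ K) ^+ D) ^+ q :> R.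
  by have /andP[h0 h1] := q01; rewrite exprn_ge0// subr_ge0 exprn_ile1.
have [v phi psi e|v|v||phi phiB] :=
    @local_lemma R V 'I_q V B T _ ((K.+1 * D) ^ 2) _ _ _ _ p0 pD q0'.
- rewrite /B /T in e *; case: (last v) e => [e|_]; last by rewrite !inE.
  rewrite !inE; apply: eq_forallb => j; apply: eq_existsb => f.
  case fv: (f \in link E v) => //=; apply: eq_forallb => u.
  case uf: (u \in f) => //=; rewrite e//.
  by apply/bigcupP; exists f.
- rewrite /B; case: (last v); last by rewrite cards0 mulr_ge0.
  apply: le_trans (@card_blocked R V 'I_q (link E v) (m v) _ _ q0' K D _ _) _;
    last by rewrite card_ord.
  + by move=> u i j j'; rewrite /m => /eqP-> /eqP/linj.
  + by move=> u i i' j; rewrite /m => /eqP <- /eqP/linj.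
  + move=> f /imsetP[e]; rewrite inE => /andP[eE ve] ->.
    by have := Ek _ eE; rewrite (cardsD1 v) ve => -[].
  by apply: leq_trans (leq_imset_card _ _) (card_star v ED).
- apply: leq_trans (card_meeting_links v Ek ED); apply/subset_leq_card/subsetP.
  move=> w; rewrite !inE /T; case: (last v); last by rewrite set0I eqxx.
  by case: (last w) => //; rewrite setI0 eqxx.
- by rewrite expn_gt0 muln_gt0 D0.
have /choice[g gP] v : exists j, last v -> forall f, f \in link E v ->
    exists2 u, u \in f & l u (phi u) != l v j.
  case lv: (last v); last by exists (Ordinal q0).
  have := phiB v; rewrite /B lv inE => /forallPn[j /existsPn h].
  exists j => _ f fv; have := h f; rewrite fv /= => /forall_inPn[u uf um].
  by exists u.
exists (fun v => if last v then l v (g v) else l v (phi v)); split.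
  by move=> v; case: ifP => _; have [] := lP v.
move=> e eE.
have e1 := partE e eE ord_max.
have /card_gt0P[v] : (0 < #|[pred v in e | part v == ord_max]|)%N by rewrite e1.
rewrite inE => /andP[ve lv].
have uniq_last u : u \in e -> last u -> u = v.
  move=> ue lu; have /card_le1_eqP := eq_leq e1.
  by apply; rewrite inE; apply/andP.
have [|u] := gP v lv (e :\ v).
  by apply/imsetP; exists e; rewrite // inE eE.
rewrite in_setD1 => /andP[uv ue] /eqP uc; exists u, v; split=> //.
(* Since [v] is the only vertex of [e] in the last part, [u] keeps its random colour, which differs
   from that of [v]. *)
rewrite [last v]lv; case: ifP => // /(uniq_last u ue) uv'.
by rewrite uv' eqxx in uv.
Qed.
End ListColoring.

Theorem theorem1p3 (R : realType) (eps : R) (k : nat) :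
  0 < eps -> (2 <= k)%N ->
  exists Delta0 : nat, forall Delta : nat, (Delta0 <= Delta)%N ->
    forall (V : finType) (E : {set {set V}}),
      uniform k E -> partite k E -> (max_degree E <= Delta)%N ->
      (list_chromatic_number E)%:R <=
        ((k%:R - 1 + eps) * (Delta%:R / ln (Delta%:R : R)))
          `^ ((k%:R - 1)^-1).
Proof.
case: k => [//|K] e0; rewrite ltnS => K0.
have [D0 HD] := @exists_list_size R eps K e0 K0.
(* The maximum with 1 supplies the hypothesis [0 < D] of [partite_choosable]. *)
exists (maxn D0 1) => D; rewrite geq_max => /andP[D0D D1] V E Ek Ep ED.
have [q [q0 qle pD]] := HD D D0D.
have Eq := partite_choosable Ek Ep ED D1 q0 pD.
have [_ /(_ _ Eq) le_q] := list_chromatic_numberP (K0 : (2 <= K.+1)%N) Ek.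
have -> : K.+1%:R - 1 = K%:R :> R by rewrite -natr1 addrK.
by apply: le_trans qle; rewrite ler_nat.
Qed.
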